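(* Let $(V,\mathcal{Y},c)$ be a graded vertex coalgebra, let $v'\in(V^{\otimes3})'$ and $v\in V$. (a) (Right rationality) The formal series $\langle v',(Id_V\otimes\mathcal{Y}(x_2))\mathcal{Y}(x_1)v\rangle$ is in $\mathbb{F}[x_1,x_2^{-1}][[x_1^{-1},x_2]]$ and in fact $$\langle v',(Id_V\otimes\mathcal{Y}(x_2))\mathcal{Y}(x_1)v\rangle=\iota_{12}f(x_1,x_2)$$ where $f(x_1,x_2)\in\mathbb{F}[x_1,x_2]_S$ is uniquely determined and is of the form $$f(x_1,x_2)=\frac{g(x_1,x_2)}{x_1^rx_2^s(x_1-x_2)^t}$$ for some $g(x_1,x_2)\in\mathbb{F}[x_1,x_2]$ and $r,s,t\in\mathbb{N}$. (b) (Cocommutativity) It is also the case that $$\iota_{12}^{-1}\langle v',(Id_V\otimes\mathcal{Y}(x_2))\mathcal{Y}(x_1)v\rangle=\iota_{21}^{-1}\langle v',(T\otimes Id_V)(Id_V\otimes\mathcal{Y}(x_1))\mathcal{Y}(x_2)v\rangle.$$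
   Context: All vector spaces are over a field $\mathbb{F}$ of characteristic $0$; $x,x_0,x_1,x_2$ are commuting formal variables; $\mathbb{N}$ is the set of nonnegative integers. $\delta(x)=\sum_{n\in\mathbb{Z}}x^n$. For $n\in\mathbb{Z}$, $(x_i\pm x_j)^n$ as a formal series is expanded in nonnegative integral powers of the second listed variable $x_j$ (this also applies inside $\delta$). $W[[x,x^{-1}]]$ is the space of all doubly infinite formal series with coefficients in $W$, and $W((x^{-1}))$ is the space of those with only finitely many positive powers of $x$. $T(u\otimes v)=v\otimes u$ on $V\otimes V$. Linear maps and pairings act on formal series coefficientwise. A vertex coalgebra $(V,\mathcal{Y},c)$ is a vector space $V$ with linear maps $\mathcal{Y}(x):V\to(V\otimes V)[[x,x^{-1}]]$ and $c:V\to\mathbb{F}$ such that for all $v\in V$: 1. Left counit: $(c\otimes Id_V)\mathcal{Y}(x)v=v$. 2. Cocreation: $(Id_V\otimes c)\mathcal{Y}(x)v\in V[[x]]$ and $\lim_{x\to0}(Id_V\otimes c)\mathcal{Y}(x)v=v$. 3. Truncation: $\mathcal{Y}(x)v\in(V\otimes V)((x^{-1}))$. 4. Jacobi identity: $$x_0^{-1}\delta\left(\tfrac{x_1-x_2}{x_0}\right)(Id_V\otimes\mathcal{Y}(x_2))\mathcal{Y}(x_1)-x_0^{-1}\delta\left(\tfrac{x_2-x_1}{-x_0}\right)(T\otimes Id_V)(Id_V\otimes\mathcal{Y}(x_1))\mathcal{Y}(x_2)=x_2^{-1}\delta\left(\tfrac{x_1-x_0}{x_2}\right)(\mathcal{Y}(x_0)\otimes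 Id_V)\mathcal{Y}(x_2).$$ It is a graded vertex coalgebra if $V=\coprod_{k\in\mathbb{Z}}V_{(k)}$ is $\mathbb{Z}$-graded with $V_{(k)}=0$ for $k$ sufficiently negative and, writing $\mathcal{Y}(x)v=\sum_{k\in\mathbb{Z}}\Delta_k(v)x^{-k-1}$, one has $\Delta_k(v)\in(V\otimes V)_{(r+k+1)}$ for all $v\in V_{(r)}$ and $r,k\in\mathbb{Z}$. For a graded space $W=\coprod_k W_{(k)}$, the graded dual is $W'=\coprod_k \mathrm{Hom}(W_{(k)},\mathbb{F})$, and $\langle\cdot,\cdot\rangle$ is the natural pairing of $W'$ with $W$. $V^{\otimes n}$ is graded by total weight, and $(V^{\otimes n})'$ is its graded dual. $\mathbb{F}[x_1,x_2]_S$ is the ring of rational functions obtained from $\mathbb{F}[x_1,x_2]$ by inverting products of elements of $S$, the set of nonzero homogeneous linear polynomials in $x_1,x_2$. The injective map $\iota_{12}:\mathbb{F}[x_1,x_2]_S\to\mathbb{F}[[x_1,x_1^{-1},x_2,x_2^{-1}]]$ expands denominators in nonnegative powers of $x_2$: it sends $\frac{g(x_1,x_2)}{x_1^rx_2^s(x_1-x_2)^t}$ to $\frac{g(x_1,x_2)}{x_1^rx_2^s}$ times the expansion of $(x_1-x_2)^{-t}$ in nonnegative powers of $x_2$. $\iota_{21}$ is defined in the same way with expansion in nonnegative powers of $x_1$. $\iota_{12}^{-1}$ and $\iota_{21}^{-1}$ are the inverses on the images. *)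

(* Defs.v *)
From HB Require Import structures.
From mathcomp Require Import all_boot all_order all_algebra.
From mathcomp Require Import generic_quotient.
From mathcomp Require Import boolp classical_sets functions cardinality fsbigop.

Set Implicit Arguments.
Unset Strict Implicit.
Unset Printing Implicit Defensive.

Import Order.TTheory GRing.Theory Num.Theory.
Local Open Scope quotient_scope.
Local Open Scope ring_scope.
Local Open Scope classical_set_scope.

(******************************************************************************)
(* Tensor product of vector spaces, as finite formal sums of pairs (lists)    *)
(* modulo the congruence generated by commutativity and the bilinearity       *)
(* relations. The rule teq_zero is needed since lists only form a monoid.     *)
(******************************************************************************)

Inductive teq (F : fieldType) (V W : lmodType F) :
    seq (V * W) -> seq (V * W) -> Prop :=
| teq_refl s : teq s s
| teq_sym s t : teq s t -> teq t s
| teq_trans s t u : teq s t -> teq t u -> teq s u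
| teq_cat s s' t t' : teq s s' -> teq t t' -> teq (s ++ t) (s' ++ t')
| teq_comm s t : teq (s ++ t) (t ++ s)
| teq_addl v1 v2 w : teq [:: (v1 + v2, w)] [:: (v1, w); (v2, w)]
| teq_addr v w1 w2 : teq [:: (v, w1 + w2)] [:: (v, w1); (v, w2)]
| teq_scale a v w : teq [:: (a *: v, w)] [:: (v, a *: w)]
| teq_zero w : teq [:: (0, w)] [::].

Lemma linear_for0 (F : fieldType) (V U : lmodType F) (f : V -> U) :
  linear f -> f 0 = 0.
Proof. by move=> hf; have := hf (-1) 0 0; rewrite !scaleN1r !addNr. Qed.

Section Tensor.
Variables (F : fieldType) (V W : lmodType F).

Definition teqb (s t : seq (V * W)) : bool := `[< teq s t >].

Lemma teqb_refl : reflexive teqb.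
Proof. by move=> s; apply/asboolP/teq_refl. Qed.

Lemma teqb_sym : symmetric teqb.
Proof. by move=> s t; apply/asboolP/asboolP; apply: teq_sym. Qed.

Lemma teqb_trans : transitive teqb.
Proof.
by move=> t s u /asboolP st /asboolP tu; apply/asboolP/(teq_trans st tu).
Qed.

Canonical teqb_equiv := EquivRel teqb teqb_refl teqb_sym teqb_trans.

Definition tens : Type := {eq_quot teqb_equiv}.
HB.instance Definition _ := Choice.on tens.

Definition tpi (s : seq (V * W)) : tens := \pi_{eq_quot teqb_equiv} s.
Definition trepr (x : tens) : seq (V * W) := repr (x : {eq_quot teqb_equiv}).

Lemma treprK x : tpi (trepr x) = x.
Proof. exact: reprK. Qed.

Lemma tpiP s t : tpi s = tpi t <-> teq s t.
Proof.
split; first by move=> /eqmodP /asboolP.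
by move=> st; apply/eqmodP/asboolP.
Qed.

Lemma trepr_pi s : teq (trepr (tpi s)) s.
Proof. by apply/tpiP; rewrite treprK. Qed.

Definition tscale_seq (a : F) (s : seq (V * W)) := [seq (a *: p.1, p.2) | p <- s].

Definition tadd (x y : tens) := tpi (trepr x ++ trepr y).
Definition tscale (a : F) (x : tens) := tpi (tscale_seq a (trepr x)).
Definition topp (x : tens) := tscale (-1) x.

Lemma tadd_pi s t : tadd (tpi s) (tpi t) = tpi (s ++ t).
Proof. by apply/tpiP; apply: teq_cat; apply: trepr_pi. Qed.

Lemma teq_scale_seq a s t : teq s t -> teq (tscale_seq a s) (tscale_seq a t).
Proof.
elim=> {s t} /=.
- by move=> s; apply: teq_refl.
- by move=> s t _; apply: teq_sym.
- by move=> s t u _ st _; apply: teq_trans st.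
- move=> s s' t t' _ h _ h'; rewrite /tscale_seq !map_cat.
  exact: teq_cat.
- by move=> s t; rewrite /tscale_seq !map_cat; apply: teq_comm.
- by move=> v1 v2 w; rewrite scalerDr; apply: teq_addl.
- by move=> v w1 w2; apply: teq_addr.
- by move=> b v w; rewrite scalerA mulrC -scalerA; apply: teq_scale.
- by move=> w; rewrite scaler0; apply: teq_zero.
Qed.

Lemma tscale_pi a s : tscale a (tpi s) = tpi (tscale_seq a s).
Proof. by apply/tpiP/teq_scale_seq/trepr_pi. Qed.

Lemma taddA : associative tadd.
Proof.
by move=> x y z; rewrite -[x]treprK -[y]treprK -[z]treprK !tadd_pi catA.
Qed.

Lemma taddC : commutative tadd.
Proof.
by move=> x y; rewrite -[x]treprK -[y]treprK !tadd_pi; apply/tpiP/teq_comm.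
Qed.

Lemma tadd0 : left_id (tpi [::]) tadd.
Proof. by move=> x; rewrite -[x]treprK tadd_pi. Qed.

Lemma tscaleDl (x : tens) a b : tscale (a + b) x = tadd (tscale a x) (tscale b x).
Proof.
rewrite -[x]treprK !tscale_pi tadd_pi; apply/tpiP.
elim: (trepr x) => [|[v w] s ih] /=; first exact: teq_refl.
rewrite -[X in teq X _]cat1s scalerDl.
apply: teq_trans (teq_cat (teq_addl _ _ _) ih) _.
set A := tscale_seq a s; set B := tscale_seq b s.
apply: (@teq_cat _ _ _ [:: _] [:: _] _ _ (teq_refl _)).
rewrite -[X in teq X _]/(([:: (b *: v, w)] ++ A) ++ B).
rewrite -[X in teq _ X]/(A ++ ([:: (b *: v, w)] ++ B)) catA.
by apply: teq_cat; [exact: teq_comm|exact: teq_refl].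
Qed.

Lemma tscale0 (x : tens) : tscale 0 x = tpi [::].
Proof.
rewrite -[x]treprK tscale_pi; apply/tpiP.
elim: (trepr x) => [|[v w] s ih] /=; first exact: teq_refl.
rewrite scale0r.
exact: (@teq_cat _ _ _ [:: _] [::] _ [::] (teq_zero _ _) ih).
Qed.

Lemma tscale1 : left_id 1 tscale.
Proof.
move=> x; rewrite -[x in LHS]treprK tscale_pi -[RHS]treprK; congr tpi.
by rewrite -[RHS]map_id; apply: eq_map => -[v w] /=; rewrite scale1r.
Qed.

Lemma taddN : left_inverse (tpi [::]) topp tadd.
Proof. by move=> x; rewrite -[x in tadd _ x]tscale1 -tscaleDl addNr tscale0. Qed.

HB.instance Definition _ := GRing.isZmodule.Build tens taddA taddC tadd0 taddN.

Lemma tscaleA a b (x : tens) : tscale a (tscale b x) = tscale (a * b) x.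
Proof.
rewrite -[x]treprK !tscale_pi; congr tpi; rewrite /tscale_seq -map_comp.
by apply: eq_map => -[v w] /=; rewrite scalerA.
Qed.

Lemma tscaleDr : right_distributive tscale (@GRing.add tens).
Proof.
move=> a x y; rewrite -[x]treprK -[y]treprK [_ + _]tadd_pi !tscale_pi.
by rewrite [RHS]tadd_pi /tscale_seq map_cat.
Qed.

HB.instance Definition _ := GRing.Zmodule_isLmodule.Build F tens
  tscaleA tscale1 tscaleDr (fun x a b => tscaleDl x a b).

Definition tpure (v : V) (w : W) : tens := tpi [:: (v, w)].

(* The linear map induced by b; meaningful only when b is bilinear. *)
Definition tlift (U : lmodType F) (b : V -> W -> U) (x : tens) : U :=
  \sum_(p <- trepr x) b p.1 p.2.

Definition bilin (U : lmodType F) (b : V -> W -> U) : Prop :=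
  (forall v, linear (b v)) /\ (forall w, linear (b^~ w)).

Lemma bilin_tpure : bilin tpure.
Proof.
have scl a v w : tpure (a *: v) w = a *: tpure v w by rewrite [RHS]tscale_pi.
split=> [v a w1 w2|w a v1 v2].
  rewrite -scl; transitivity (tpi [:: (v, a *: w1); (v, w2)]).
    by apply/tpiP/teq_addr.
  rewrite -[RHS]/(tadd _ _) tadd_pi; apply/tpiP; rewrite -cat1s.
  by apply: teq_cat; [apply/teq_sym/teq_scale|apply: teq_refl].
by rewrite -scl -[RHS]/(tadd _ _) tadd_pi; apply/tpiP/teq_addl.
Qed.

Section Universal.
Variables (U : lmodType F) (b : V -> W -> U) (hb : bilin b).

Let bl v : linear (b v) := hb.1 v.
Let br w : linear (b^~ w) := hb.2 w.

Lemma bilin_teq s t : teq s t ->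
  \sum_(p <- s) b p.1 p.2 = \sum_(p <- t) b p.1 p.2.
Proof.
have b0 w : b 0 w = 0 := linear_for0 (br w).
have b0r v : b v 0 = 0 := linear_for0 (bl v).
elim=> {s t} //=.
- by move=> s t u _ -> _ ->.
- by move=> s s' t t' _ h _ h'; rewrite !big_cat /= h h'.
- by move=> s t; rewrite !big_cat /= addrC.
- move=> v1 v2 w; rewrite !big_cons !big_nil /= !addr0.
  by have := br w 1 v1 v2; rewrite !scale1r.
- move=> v w1 w2; rewrite !big_cons !big_nil /= !addr0.
  by have := bl v 1 w1 w2; rewrite !scale1r.
- move=> a v w; rewrite !big_cons !big_nil /= !addr0.
  have := br w a v 0; rewrite !addr0 b0 addr0 => ->.
  by have := bl v a w 0; rewrite !addr0 b0r addr0 => ->.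
- by move=> w; rewrite !big_cons !big_nil /= b0 addr0.
Qed.

Lemma tliftE v w : tlift b (tpure v w) = b v w.
Proof. by rewrite /tlift (bilin_teq (trepr_pi _)) big_seq1. Qed.

Lemma tlift_linear : linear (tlift b).
Proof.
have pi s : tlift b (tpi s) = \sum_(p <- s) b p.1 p.2.
  exact: bilin_teq (trepr_pi _).
move=> a x y; rewrite -[x]treprK -[y]treprK.
rewrite [_ *: _]tscale_pi [_ + _]tadd_pi !pi big_cat /=; congr (_ + _).
rewrite big_map scaler_sumr; apply: eq_bigr => -[v w] _ /=.
have b0 : b 0 w = 0 := linear_for0 (br w).
by have := br w a v 0; rewrite addr0 b0 addr0.
Qed.

End Universal.

Lemma tens_sum (x : tens) : exists s : seq (V * W), x = \sum_(p <- s) tpure p.1 p.2.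
Proof.
exists (trepr x); rewrite -[x in LHS]treprK.
elim: (trepr x) => [|[v w] s ih]; first by rewrite big_nil.
by rewrite big_cons -ih [RHS]tadd_pi.
Qed.

End Tensor.

Section TensorMaps.
Variable F : fieldType.
Implicit Types V W U : lmodType F.

Definition tmap V W V' W' (f : V -> V') (g : W -> W') : tens V W -> tens V' W' :=
  tlift (fun v w => tpure (f v) (g w)).

Definition tswap V W : tens V W -> tens W V := tlift (fun v w => tpure w v).

Definition tassoc V W U : tens V (tens W U) -> tens (tens V W) U :=
  tlift (fun v t => tlift (fun w u => tpure (tpure v w) u) t).

End TensorMaps.

Definition tens3 (F : fieldType) (V : lmodType F) : lmodType F :=
  tens (tens V V) V.

Section Gradings.
Variable F : fieldType.

Definition grading (V : lmodType F) (Vg : int -> set V) : Prop :=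
  (forall k, Vg k 0 /\ forall a u v, Vg k u -> Vg k v -> Vg k (a *: u + v)) /\
  (forall v, exists! f : int -> V,
     [/\ finite_set [set k | f k != 0], forall k, Vg k (f k)
       & v = \sum_(k \in setT) f k]).

(* Degree n part of V (x) W, the sum of the images of V_(k) (x) W_(n-k). *)
Definition tgrade (V W : lmodType F) (Vg : int -> set V) (Wg : int -> set W)
    (n : int) : set (tens V W) :=
  [set x | exists2 s : seq (V * W),
     (forall p, p \in s -> exists k, Vg k p.1 /\ Wg (n - k) p.2)
     & x = \sum_(p <- s) tpure p.1 p.2].

(* An element of the coproduct of the Hom(W_(k), F) is identified with the
   functional on W restricting to its components; the natural pairing is then
   evaluation. *)
Definition graded_dual (W : lmodType F) (Wg : int -> set W) (phi : W -> F) :=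
  finite_set [set k | exists2 w, Wg k w & phi w != 0].

End Gradings.

(******************************************************************************)
(* Formal series: a doubly infinite formal series with exponents in M         *)
(* (M = int, int * int, int * int * int) is its family of coefficients.       *)
(******************************************************************************)

Definition fseries (M W : Type) : Type := M -> W.

Section Series.
Variable F : fieldType.

(* Cauchy product; it is only used where all the sums involved are finite. *)
Definition smul (M : zmodType) (W : lmodType F)
    (A : fseries M F) (B : fseries M W) : fseries M W :=
  fun m => \sum_(i \in setT) A i *: B (m - i).

Definition smono (M : zmodType) (W : lmodType F) (d : M) (w : W) : fseries M W :=
  fun m => if m == d then w else 0.

Definition zbin (n : int) (k : nat) : F :=
  (\prod_(i < k) (n - i%:Z)%:~R) / (k`!)%:R.

(* (a y + b z)^n expanded in nonnegative powers of z; exponents of (y, z) *)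
Definition binexp (a b : F) (n : int) : fseries (int * int) F :=
  fun m => if (0 <= m.2) && (m.1 + m.2 == n)
           then zbin n `|m.2|%N * a ^ m.1 * b ^ m.2 else 0.

(* x^-1 delta((y - z) / (eps x)) = \sum_n eps^-n x^(-n-1) (y - z)^n;
   coefficient of x^ex y^ey z^ez *)
Definition delta3 (eps : F) (ex ey ez : int) : F :=
  let n := - ex - 1 in eps ^ (- n) * binexp 1 (-1) n (ey, ez).

End Series.

(******************************************************************************)
(* Y v n is the coefficient of x^n in Y(x)v.                                  *)
(******************************************************************************)

Section VertexCoalgebra.
Variables (F : fieldType) (V : lmodType F).
Variables (Y : {linear V -> (int -> tens V V)}) (c : {scalar V}).

(* (Id (x) Y(x2)) Y(x1) v, exponents of (x1, x2) *)
Definition iter_right (v : V) : fseries (int * int) (tens3 V) :=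
  fun m => tassoc (tmap idfun (fun u => Y u m.2) (Y v m.1)).

(* (T (x) Id) (Id (x) Y(x1)) Y(x2) v, exponents of (x1, x2) *)
Definition iter_swap (v : V) : fseries (int * int) (tens3 V) :=
  fun m => tmap (@tswap F V V) idfun
             (tassoc (tmap idfun (fun u => Y u m.1) (Y v m.2))).

(* (Y(x0) (x) Id) Y(x2) v, exponents of (x0, x2) *)
Definition iter_left (v : V) : fseries (int * int) (tens3 V) :=
  fun m => tmap (fun u => Y u m.1) idfun (Y v m.2).

(* Exponents of (x0, x1, x2). Each sum is finite by truncation. *)
Definition jacobi (v : V) : Prop :=
  smul (fun m : int * int * int => delta3 1 m.1.1 m.1.2 m.2)
       (fun m => if m.1.1 == 0 then iter_right v (m.1.2, m.2) else 0)
  - smul (fun m : int * int * int => delta3 (-1) m.1.1 m.2 m.1.2)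
       (fun m => if m.1.1 == 0 then iter_swap v (m.1.2, m.2) else 0)
  = smul (fun m : int * int * int => delta3 1 m.2 m.1.2 m.1.1)
       (fun m => if m.1.2 == 0 then iter_left v (m.1.1, m.2) else 0).

(* c (x) Id and Id (x) c are read through F (x) V = V = V (x) F. *)
Record vertex_coalgebra : Prop := {
  left_counit : forall v n,
    tlift (fun u w => c u *: w) (Y v n) = smono 0 v n;
  cocreation : forall v,
    (forall n, n < 0 -> tlift (fun u w => c w *: u) (Y v n) = 0) /\
    tlift (fun u w => c w *: u) (Y v 0) = v;
  truncation : forall v, exists N : int, forall n, N < n -> Y v n = 0;
  jacobi_identity : forall v, jacobi v
}.

(* Delta k v is the coefficient of x^(-k-1) in Y(x)v. *)
Definition Delta (k : int) (v : V) : tens V V := Y v (- k - 1).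

Record graded_vertex_coalgebra (Vg : int -> set V) : Prop := {
  gvc_vertex : vertex_coalgebra;
  gvc_grading : grading Vg;
  gvc_lower : exists N : int, forall k v, k < N -> Vg k v -> v = 0;
  gvc_weight : forall r k v, Vg r v -> tgrade Vg Vg (r + k + 1) (Delta k v)
}.

End VertexCoalgebra.

(******************************************************************************)
(* Rational functions and their expansions. F[x1, x2] is {poly {poly F}},     *)
(* with inner variable x1 and outer variable x2.                              *)
(******************************************************************************)

Section Rational.
Variable F : fieldType.

Definition px1 : {poly {poly F}} := 'X%:P.
Definition px2 : {poly {poly F}} := 'X.

Definition ratfun : fieldType := {fraction {poly {poly F}}}.

(* The homogeneous linear polynomial a x1 + b x2, which is nonzero if and only
   if (a, b) is. *)
Definition lin (l : F * F) : {poly {poly F}} :=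
  (l.1%:P)%:P * px1 + (l.2%:P)%:P * px2.

Definition frac_of (g : {poly {poly F}}) (s : seq (F * F)) : ratfun :=
  tofrac g / \prod_(l <- s) tofrac (lin l).

(* F[x1, x2]_S *)
Definition ratS : set ratfun :=
  [set f | exists g (s : seq (F * F)), 0 \notin s /\ f = frac_of g s].

Definition poly_fser (g : {poly {poly F}}) : fseries (int * int) F :=
  fun m => if (0 <= m.1) && (0 <= m.2) then g`_(`|m.2|%N)`_(`|m.1|%N) else 0.

(* (a x1 + b x2)^-1 expanded in nonnegative powers of x2, resp. x1 *)
Definition linv12 (l : F * F) : fseries (int * int) F :=
  if l.1 != 0 then binexp l.1 l.2 (-1)
  else @smono F (int * int)%type F^o (0, -1) l.2^-1.

Definition linv21 (l : F * F) : fseries (int * int) F :=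
  fun m => linv12 (l.2, l.1) (m.2, m.1).

(* The series expanding f, given the expansions of the inverses of the linear
   polynomials; it does not depend on the presentation g, s of f. *)
Definition expand (linv : F * F -> fseries (int * int) F) (f : ratfun) :
    fseries (int * int) F :=
  xget (fun=> 0)
    [set A : int * int -> F | exists g (s : seq (F * F)), [/\ 0 \notin s, f = frac_of g s
       & A = @smul F (int * int)%type F^o (poly_fser g)
               (\big[@smul F (int * int)%type F^o
                    /@smono F (int * int)%type F^o 0 1]_(l <- s) linv l)]].

Definition iota12 := expand linv12.
Definition iota21 := expand linv21.

Definition iota12_inv : fseries (int * int) F -> ratfun :=
  'pinv_(fun=> 0) ratS iota12.
Definition iota21_inv : fseries (int * int) F -> ratfun :=
  'pinv_(fun=> 0) ratS iota21.

(* F[x1, x2^-1][[x1^-1, x2]]: the exponents of x1 are bounded above and those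
   of x2 are bounded below. *)
Definition right_fseries (A : fseries (int * int) F) : Prop :=
  exists N M : int, forall p q, A (p, q) != 0 -> p <= N /\ M <= q.

End Rational.

(* Main.v *)
Require Import Defs.
From HB Require Import structures.
From mathcomp Require Import all_boot all_order all_algebra.
From mathcomp Require Import finmap.
From mathcomp Require Import boolp classical_sets functions cardinality fsbigop.
From mathcomp Require Import zify ring.

Set Implicit Arguments.
Unset Strict Implicit.
Unset Printing Implicit Defensive.

Import Order.TTheory GRing.Theory Num.Theory.
Local Open Scope ring_scope.
Local Open Scope classical_set_scope.

(** Why the theorem holds.

    Weights first. For v of weight r the coefficient of x1^p x2^q in each of
    the three iterated coproducts of v has weight r - p - q, and v' sees only
    finitely many weights; hence every series obtained by pairing with v' has
    p + q in a bounded range (paired_degree_bounds). Truncation bounds one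
    exponent from above, so the total degree bounds the other one from below
    (right_fseries_iter).

    The same bound applied to the right-hand side of the Jacobi identity shows
    that, after pairing with v', its exponents of x0 are bounded below: the
    delta function there only contributes nonnegative powers of x0. Comparing
    the coefficients of x0^(-t-1) for t large makes the right-hand side vanish,
    and on the left both delta functions contribute the polynomial
    (x1 - x2)^t. This is weak cocommutativity (locality):
      (x1 - x2)^t R = (x1 - x2)^t S.
    The exponent of x1 is bounded above in the left member, that of x2 in the
    right member, and p + q is bounded, so the common value is a Laurent
    polynomial g / (x1^r x2^s) (laurent_poly), and R and S ought to be the two
    expansions of g / (x1^r x2^s (x1 - x2)^t).

    To make the last step precise, the Cauchy product is replaced by the
    action of linear forms on series, which is given by finite sums. For the
    series whose exponents are bounded in the direction of the expansion, a
    nonzero linear form acts injectively, and the expansion of g / (l1 ... ln)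
    is the only such series A with l1 ... ln A = g (expandE). This
    characterization shows at once that the expansion does not depend on the
    presentation of the rational function, that it is injective (expand_inj),
    and that R and S are the expansions of the same fraction
    (common_expansion). *)

(** * The action of linear forms on series *)

Definition sone (F : fieldType) : fseries (int * int) F :=
  @smono F (int * int)%type F^o 0 1.

(** The Cauchy product with the values of the second factor read in F rather
    than in the regular module F^o, so that both factors have the same type. *)
Definition fsmul (F : fieldType) (A B : fseries (int * int) F) :
    fseries (int * int) F := @smul F (int * int)%type F^o A B.

(** The product of the polynomial l.1 x1 + l.2 x2 with A. It has two terms in
    each degree, so that it makes sense for all doubly infinite series. *)
Definition lact (F : fieldType) (l : F * F) (A : fseries (int * int) F) :
    fseries (int * int) F :=
  fun m => l.1 * A (m - (1, 0)) + l.2 * A (m - (0, 1)).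

Definition lacts (F : fieldType) (s : seq (F * F)) (A : fseries (int * int) F) :=
  foldr (@lact F) A s.

(** Only the supports are assumed finite: the index type may be infinite, as
    it is in a Cauchy product. *)
Lemma fsumD (I : choiceType) (W : zmodType) (f g : I -> W) :
  finite_set [set i | f i != 0] -> finite_set [set i | g i != 0] ->
  \sum_(i \in setT) (f i + g i) = \sum_(i \in setT) f i + \sum_(i \in setT) g i.
Proof.
move=> ff fg.
have fU : finite_set ([set i | f i != 0] `|` [set i | g i != 0]).
  by rewrite finite_setU.
have out i : i \notin fset_set ([set i | f i != 0] `|` [set i | g i != 0]) ->
    f i = 0 /\ g i = 0.
  rewrite in_fset_set // => /negP h; split; apply/eqP/negPn/negP => nz;
  by apply: h; rewrite inE; (left + right); exact: nz.
have E (h : I -> W) := @fsbigTE W 0 +%R I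
  (fset_set ([set i | f i != 0] `|` [set i | g i != 0])) h.
rewrite !E ?big_split // => i /out[fi gi]; by rewrite ?fi ?gi ?addr0.
Qed.

Section Action.
Variable F : fieldType.
Implicit Types (A B : fseries (int * int) F) (l : F * F) (s : seq (F * F)).

Lemma soneE p q : sone F (p, q) = ((p == 0) && (q == 0))%:R.
Proof. by rewrite /sone /smono -[(p, q) == 0]/(_ && _); case: andb. Qed.

Lemma lactE l A p q : lact l A (p, q) = l.1 * A (p - 1, q) + l.2 * A (p, q - 1).
Proof. by rewrite /lact; congr (_ * A _ + _ * A _); congr pair; rewrite /= subr0. Qed.

Lemma lactC l l' A : lact l (lact l' A) = lact l' (lact l A).
Proof.
apply/funext => m; rewrite /lact.
by rewrite (addrAC m (- (0, 1)) (- (1, 0))); ring.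
Qed.

Lemma lact_lacts l s A : lact l (lacts s A) = lacts s (lact l A).
Proof. by elim: s => //= l' s <-; rewrite lactC. Qed.

Lemma lacts_cat s s' A : lacts (s ++ s') A = lacts s (lacts s' A).
Proof. by rewrite /lacts foldr_cat. Qed.

Lemma lactsC s s' A : lacts s (lacts s' A) = lacts s' (lacts s A).
Proof. by elim: s => //= l s ->; rewrite lact_lacts. Qed.

Lemma fsmulC A B : fsmul A B = fsmul B A.
Proof.
apply/funext => m; rewrite /fsmul /smul.
rewrite (@reindex_fsbigT _ _ _ _ _ (fun i : int * int => m - i)).
  by apply: eq_fsbigr => i _; rewrite /GRing.scale /= mulrC subKr.
by exists (fun i : int * int => m - i) => i; rewrite subKr.
Qed.

Lemma smul_one A : fsmul A (sone F) = A.
Proof.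
apply/funext => m; rewrite /fsmul /smul.
rewrite (fsbigTE [fset m]%fset) ?big_seq_fset1.
  by rewrite /sone /smono subrr eqxx /GRing.scale /= mulr1.
move=> i; rewrite inE /sone /smono subr_eq0 eq_sym => /negbTE ->.
by rewrite scaler0.
Qed.

(** The hypothesis cannot be dropped: a Cauchy sum with infinite support has
    the value 0. *)
Lemma lact_smulr l A B :
  (forall m, finite_set [set i | A i * B (m - i) != 0]) ->
  lact l (fsmul A B) = fsmul A (lact l B).
Proof.
move=> fin; apply/funext => m; rewrite /lact /fsmul /smul.
have push (a : F) n : a * \sum_(i \in setT) (A i *: (B (n - i) : F^o)) =
    \sum_(i \in setT) (a * (A i * B (n - i))).
  by rewrite mulr_fsumr.
have sup (a : F) n : finite_set [set i | a * (A i * B (n - i)) != 0].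
  by apply: sub_finite_set (fin n) => i /=; apply: contra => /eqP ->; rewrite mulr0.
rewrite !push -fsumD //; apply: eq_fsbigr => i _.
rewrite /GRing.scale /= !(addrAC m (- i)); ring.
Qed.

End Action.

(** * Polynomials as series, and equality of fractions *)

Section Polynomials.
Variable F : fieldType.
Implicit Types (g : {poly {poly F}}) (l : F * F) (s : seq (F * F)).

Lemma poly_fserD g h m : poly_fser (g + h) m = poly_fser g m + poly_fser h m.
Proof. by rewrite /poly_fser; case: ifP; rewrite ?addr0 // !coefD. Qed.

Lemma poly_fserZ (a : F) g m : poly_fser (a%:P%:P * g) m = a * poly_fser g m.
Proof. by rewrite /poly_fser; case: ifP; rewrite ?mulr0 // !coefCM. Qed.

Lemma poly_fserX1 g m : poly_fser (px1 F * g) m = poly_fser g (m - (1, 0)).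
Proof.
case: m => p q; rewrite /poly_fser /px1 /= subr0.
case: (leP 0 q) => hq; last by rewrite !andbF.
rewrite !andbT coefCM coefXM; case: p => [[|p]|p] //=.
by rewrite subn1.
Qed.

Lemma poly_fserX2 g m : poly_fser (px2 F * g) m = poly_fser g (m - (0, 1)).
Proof.
case: m => p q; rewrite /poly_fser /px2 /= subr0.
case: (leP 0 p) => hp //=.
rewrite coefXM; case: q => [[|q]|q] //=; first by rewrite coef0.
by rewrite subn1.
Qed.

Lemma poly_fser_lin l g : poly_fser (lin l * g) = lact l (poly_fser g).
Proof.
apply/funext => m.
by rewrite /lin mulrDl poly_fserD -!mulrA !poly_fserZ poly_fserX1 poly_fserX2.
Qed.

Lemma poly_fser_prod s g :
  poly_fser (\prod_(l <- s) lin l * g) = lacts s (poly_fser g).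
Proof.
elim: s => [|l s ih]; first by rewrite big_nil mul1r.
by rewrite big_cons -mulrA poly_fser_lin ih.
Qed.

Lemma poly_fser_inj : injective (@poly_fser F).
Proof.
move=> g h e; apply/polyP => i; apply/polyP => j.
by have := congr1 (fun A => A (j%:Z, i%:Z)) e; rewrite /poly_fser /=.
Qed.

Lemma poly_fser1 : poly_fser 1 = sone F.
Proof.
apply/funext => -[[p|p] [q|q]]; rewrite /poly_fser /sone /smono /= ?andbF //.
  by rewrite coef1; case: q p => [|q] [|p]; rewrite /= ?coef1 ?coef0.
by case: eqP => // /(congr1 snd).
Qed.

Lemma poly_fser_supp g :
  exists N : nat, forall m, poly_fser g m != 0 ->
    [/\ 0 <= m.1, m.1 <= N%:Z, 0 <= m.2 & m.2 <= N%:Z].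
Proof.
exists (size g + \sum_(i < size g) size (g`_i)%R)%N => -[p q].
rewrite /poly_fser /=; case: ifP => [/andP[]|]; last by rewrite eqxx.
case: p => p // _; case: q => q // _ /= nz.
have hq : (q < size g)%N.
  by rewrite ltnNge; apply: contra nz => h; rewrite (nth_default _ h) coef0.
have hp : (p < size (g`_q)%R)%N.
  by rewrite ltnNge; apply: contra nz => h; rewrite (nth_default _ h).
rewrite (bigD1 (Ordinal hq)) //=.
split=> //; rewrite lez_nat; last exact: leq_trans (ltnW hq) (leq_addr _ _).
by rewrite addnCA; exact: leq_trans (ltnW hp) (leq_addr _ _).
Qed.

Lemma fser_poly (A : fseries (int * int) F) (N : nat) :
  (forall m, A m != 0 ->
    [/\ 0 <= m.1, m.1 <= N%:Z, 0 <= m.2 & m.2 <= N%:Z]) ->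
  exists g, A = poly_fser g.
Proof.
move=> hA.
exists (\poly_(i < N.+1) \poly_(j < N.+1) A (j%:Z, i%:Z)).
apply/funext => -[p q]; rewrite /poly_fser /=.
have [e|/hA[/=]] := eqVneq (A (p, q)) 0; last first.
  case: p => p //; case: q => q // _; rewrite !lez_nat => hp _ hq /=.
  by rewrite coef_poly ltnS hq coef_poly ltnS hp.
rewrite e; case: p e => p; case: q => q //= e.
rewrite coef_poly; case: ifP; rewrite ?coef0 // coef_poly; case: ifP => //.
Qed.

(** The product of lin l with the series 1 has the two coefficients of l among
    its own. *)
Lemma lin_neq0 l : l != 0 -> lin l != 0.
Proof.
apply: contra => /eqP e.
have h m : lact l (sone F) m = 0.
  by rewrite -poly_fser1 -poly_fser_lin e mul0r /poly_fser !coef0 if_same.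
have := h (1, 0); have := h (0, 1); rewrite !lactE !soneE /=.
rewrite !(mulr1, mulr0, addr0, add0r) => h2 h1.
by case: l h1 h2 {e h} => a b /= -> ->.
Qed.

Lemma prod_lin_neq0 s : 0 \notin s -> \prod_(l <- s) lin l != 0.
Proof.
move=> hs; rewrite prodf_seq_neq0; apply/allP => l ls /=; apply: lin_neq0.
by apply: contra hs => /eqP <-.
Qed.

(** Stated in an abstract field because cross-multiplying directly in the field
    of fractions makes unification unfold the quotient construction. *)
Lemma div_eq_iff (K : fieldType) (a b x y : K) : x != 0 -> y != 0 ->
  a / x = b / y <-> a * y = b * x.
Proof.
move=> x0 y0; split=> [/eqP|e]; first by rewrite eqr_div // => /eqP.
by apply/eqP; rewrite eqr_div // e.
Qed.

Lemma frac_of_eq g s g' s' : 0 \notin s -> 0 \notin s' ->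
  frac_of g s = frac_of g' s' <->
  \prod_(l <- s') lin l * g = \prod_(l <- s) lin l * g'.
Proof.
move=> hs hs'; rewrite /frac_of -!rmorph_prod.
have nz s0 : 0 \notin s0 -> tofrac (\prod_(l <- s0) lin l) != 0 :> ratfun F.
  by move=> h; rewrite tofrac_eq0 prod_lin_neq0.
apply: (iff_trans (div_eq_iff _ _ (nz _ hs) (nz _ hs'))).
set P := \prod_(l <- s) lin l; set P' := \prod_(l <- s') lin l.
rewrite -(tofracM g P') -(tofracM g' P) (mulrC P') (mulrC P).
by split=> [/eqP|->//]; rewrite tofrac_eq => /eqP.
Qed.

End Polynomials.

(** * Binomial series and inverses of linear forms *)

Section Binomial.
Variables (F : fieldType) (charF0 : [pchar F] =i pred0).

Lemma zbin0 n : zbin F n 0 = 1.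
Proof. by rewrite /zbin big_ord0 fact0 divr1. Qed.

(** Both sides are multiples of n (n - 1) ... (n - k + 1) / (k + 1)!, with
    factors n + 1 and (n - k) + (k + 1); characteristic 0 makes the factorial
    invertible. *)
Lemma zbin_pascal n k : zbin F (n + 1) k.+1 = zbin F n k.+1 + zbin F n k.
Proof.
have nz i : (i.+1)%:R != 0 :> F by rewrite ((pcharf0P F).1 charF0).
have fnz i : (i`!)%:R != 0 :> F by rewrite ((pcharf0P F).1 charF0) -lt0n fact_gt0.
rewrite /zbin big_ord_recl [in X in _ = X + _]big_ord_recr factS natrM.
have sh (i : nat) : n + 1 - i.+1%:Z = n - i%:Z by lia.
under eq_bigr => i _ do rewrite lift0 sh.
set P := \prod_(i < k) _; rewrite !rmorphB !rmorphD /= subr0.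
by field; rewrite fnz nat1r nz.
Qed.

Lemma zbinS0 k : zbin F 0 k.+1 = 0.
Proof. by rewrite /zbin big_ord_recl /= subr0 mul0r mul0r. Qed.

(** Pascal's rule read on series: (a y + b z) (a y + b z)^n is
    (a y + b z)^(n + 1). Since n may be any integer, the case n = -1 inverts a
    linear form, and iterating from n = 0 gives the polynomial powers that
    occur in the delta functions. *)
Lemma lact_binexp (a b : F) n : a != 0 ->
  lact (a, b) (binexp a b n) = binexp a b (n + 1).
Proof.
move=> a0; apply/funext => -[p q]; rewrite lactE /binexp /=.
have ap : a ^ p = a * a ^ (p - 1).
  by rewrite -[X in X * _]expr1z -expfzDr // addrC subrK.
case: q => [[|k]|k] /=.
- rewrite !addr0 !zbin0 subr_eq mulr0 addr0; case: eqP => _; rewrite ?mulr0 //.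
  by rewrite !mul1r !mulr1 ap.
- have -> : (p - 1 + k.+1%:Z == n) = (p + k%:Z == n) by lia.
  have -> : (p + k.+1%:Z == n + 1) = (p + k%:Z == n) by lia.
  have -> : k.+1%:Z - 1 = k%:Z by lia.
  rewrite subn1 /=.
  case: eqP => _; rewrite ?mulr0 ?addr0 // zbin_pascal.
  by rewrite ap -[b ^ (k.+1)%:Z]/(b ^+ k.+1) exprS -[b ^ k%:Z]/(b ^+ k); ring.
- by rewrite !mulr0 addr0.
Qed.

Lemma binexp0 (a b : F) : binexp a b 0 = sone F.
Proof.
apply/funext => -[p q]; rewrite /binexp soneE /=; case: q => [[|k]|k] /=.
- rewrite addr0 andbT; case: eqP => // ->; by rewrite zbin0 !mulr1.
- by rewrite zbinS0 !mul0r if_same andbF.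
- by rewrite andbF.
Qed.

Lemma lact_linv12 (l : F * F) : l != 0 -> lact l (linv12 l) = sone F.
Proof.
case: l => a b /= nz; rewrite /linv12 /=; case: eqP => [a0|/eqP a0] /=.
  have b0 : b != 0 by apply: contra nz => /eqP ->; rewrite a0.
  apply/funext => -[p q]; rewrite lactE soneE /= a0 mul0r add0r.
  have -> : smono (0, -1) (b^-1 : F^o) (p, q - 1) = ((p == 0) && (q == 0))%:R * b^-1.
    rewrite /smono xpair_eqE -[q - 1 == _](inj_eq (addIr 1)) subrK addNr.
    by case: andb; rewrite ?mul1r ?mul0r.
  by rewrite mulrCA mulfV // mulr1.
by rewrite lact_binexp // addNr binexp0.
Qed.

End Binomial.

(** * Series bounded in the direction of an expansion *)

Section Support.
Variable F : fieldType.
Implicit Types (A B : fseries (int * int) F).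

Lemma finite_int_itv (a b : int) : finite_set [set k : int | a <= k <= b].
Proof.
apply: (@sub_finite_set _ _ ((fun n : nat => a + n%:Z) @` `I_(`|b - a|%N.+1))).
  move=> k /= hk; exists `|k - a|%N; rewrite /=; lia.
exact/finite_image/finite_II.
Qed.

Lemma finite_rect (a b c d : int) :
  finite_set [set m : int * int | (a <= m.1 <= b) && (c <= m.2 <= d)].
Proof.
apply: sub_finite_set (finite_setX (finite_int_itv a b) (finite_int_itv c d)).
by move=> m /= /andP.
Qed.

Lemma fsmul_neq0 A B m : fsmul A B m != 0 ->
  exists i, A i != 0 /\ B (m - i) != 0.
Proof.
rewrite /fsmul /smul => h.
have [i _] : exists2 i, setT i & A i * B (m - i) != 0.
  exact: (@fsbigN1 F 0 +%R unit _ setT (fun _ i => A i * B (m - i)) tt).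
by rewrite mulf_eq0 negb_or => /andP[h1 h2]; exists i.
Qed.

Lemma right_fseries_mul A B :
  right_fseries A -> right_fseries B -> right_fseries (fsmul A B).
Proof.
move=> [N [M hA]] [N' [M' hB]]; exists (N + N'), (M + M') => p q.
by move=> /fsmul_neq0[[i j] [/hA[? ?] /hB[/= ? ?]]]; split; lia.
Qed.

Lemma right_fseries_fin A B m :
  right_fseries A -> right_fseries B -> finite_set [set i | A i * B (m - i) != 0].
Proof.
case: m => p q [N [M hA]] [N' [M' hB]].
apply: sub_finite_set (finite_rect (p - N') N M (q - M')) => -[i j] /=.
rewrite mulf_eq0 negb_or => /andP[/hA[? ?] /hB[/= ? ?]]; lia.
Qed.

Lemma right_fseries_lact l A : right_fseries A -> right_fseries (lact l A).
Proof.
move=> [N [M hA]]; exists (N + 1), M => p q; rewrite lactE.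
have [e1|/hA[? ?] _] := eqVneq (A (p - 1, q)) 0; last by split; lia.
have [e2|/hA[? ?] _] := eqVneq (A (p, q - 1)) 0; last by split; lia.
by rewrite e1 e2 !mulr0 addr0 eqxx.
Qed.

(** If a is nonzero, then a A(p, q) + b A(p + 1, q - 1) is a coefficient of
    the product, so A(p, q) is determined by the product and A(p + 1, q - 1);
    moving in this way to larger p ends at zero coefficients, since p is
    bounded above. If a = 0 the form is a multiple of x2, which acts as a
    shift. *)
Lemma right_fseries_lact_inj l A B : l != 0 ->
  right_fseries A -> right_fseries B -> lact l A = lact l B -> A = B.
Proof.
case: l => a b l0 [N [M hA]] [N' [M' hB]] e.
have eAB p q : a * A (p - 1, q) + b * A (p, q - 1) =
    a * B (p - 1, q) + b * B (p, q - 1).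
  by have := congr1 (fun C : fseries _ F => C (p, q)) e; rewrite !lactE.
have [a0|a0] := eqVneq a 0.
  have b0 : b != 0 by apply: contra l0 => /eqP ->; rewrite a0.
  apply/funext => -[p q]; apply: (mulfI b0).
  by have := eAB p (q + 1); rewrite a0 !mul0r !add0r addrK.
(* k bounds the number of steps needed to pass both N and N'. *)
suff ind (k : nat) p q : N < p + k%:Z -> N' < p + k%:Z -> A (p, q) = B (p, q).
  by apply/funext => -[p q]; apply: (ind (`|N| + `|N'| + `|p| + 1)%N); lia.
elim: k p q => [|k ih] p q h h'.
  have -> : A (p, q) = 0 by apply/eqP/negPn/negP => /hA[? _]; lia.
  by apply/eqP; rewrite eq_sym; apply/negPn/negP => /hB[? _]; lia.
apply: (mulfI a0); have := eAB (p + 1) q; rewrite addrK.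
by rewrite (ih (p + 1) (q - 1)); [move/addIr|lia|lia].
Qed.

Lemma right_fseries_poly (g : {poly {poly F}}) : right_fseries (poly_fser g).
Proof.
have [N hN] := poly_fser_supp g; exists N%:Z, 0 => p q.
by move=> /hN[].
Qed.

Lemma right_fseries_linv12 l : right_fseries (linv12 l : fseries (int * int) F).
Proof.
exists 0, (-1) => p q; rewrite /linv12; case: ifP => _.
  by rewrite /binexp /=; case: ifP => [/andP[? /eqP ?] _|]; [split; lia|rewrite eqxx].
by rewrite /smono; have [[-> ->]|_] := eqVneq (p, q) (0, -1); rewrite ?eqxx.
Qed.

End Support.

(** * Expansions of rational functions *)

(** What a set C of series must satisfy for linv to define an injective
    expansion of rational functions with values in C. It is used for both
    directions of expansion. *)
Record expansion_class (F : fieldType)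
    (C : set (fseries (int * int) F)) (linv : F * F -> fseries (int * int) F) :
    Prop := ExpansionClass {
  ec_poly : forall g, C (poly_fser g);
  ec_mul : forall A B, C A -> C B -> C (fsmul A B);
  ec_fin : forall A B m, C A -> C B -> finite_set [set i | A i * B (m - i) != 0];
  ec_lact : forall l A, C A -> C (lact l A);
  ec_inj : forall l A B, l != 0 -> C A -> C B -> lact l A = lact l B -> A = B;
  ec_linv : forall l, C (linv l);
  ec_inv : forall l, l != 0 -> lact l (linv l) = sone F
}.

Section Expansion.
Variables (F : fieldType) (C : set (fseries (int * int) F)).
Variables (linv : F * F -> fseries (int * int) F).
Hypothesis ec : expansion_class C linv.
Implicit Types (g : {poly {poly F}}) (s : seq (F * F)).

Definition ser_of g s : fseries (int * int) F :=
  fsmul (poly_fser g)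
    (\big[@smul F (int * int)%type F^o/@smono F (int * int)%type F^o 0 1]_(l <- s)
       linv l).

Lemma ec_lacts s A : C A -> C (lacts s A).
Proof. by move=> cA; elim: s => //= l s ih; apply: (ec_lact ec). Qed.

Lemma lacts_inj s A B : 0 \notin s -> C A -> C B ->
  lacts s A = lacts s B -> A = B.
Proof.
elim: s => //= l s ih; rewrite inE negb_or eq_sym => /andP[l0 s0] cA cB.
by move/(ec_inj ec l0 (ec_lacts _ cA) (ec_lacts _ cB)); apply: ih.
Qed.

Lemma lacts_fsmul s A B : C A -> C B -> lacts s (fsmul A B) = fsmul A (lacts s B).
Proof.
move=> cA cB; elim: s => //= l s ->; apply: lact_smulr => m.
exact: (ec_fin ec m cA (ec_lacts s cB)).
Qed.

(** Acting by l on a Cauchy product passes to one factor, and turns the factor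
    linv l into 1; the forms of s thus cancel the inverses one at a time. *)
Lemma ser_ofP g s : 0 \notin s ->
  C (ser_of g s) /\ lacts s (ser_of g s) = poly_fser g.
Proof.
pose B s0 : fseries (int * int) F := \big[@smul F (int * int)%type F^o
  /@smono F (int * int)%type F^o 0 1]_(l <- s0) linv l.
have c1 : C (sone F) by rewrite -poly_fser1; exact: (ec_poly ec 1).
move=> s0; suff [cB hB] : C (B s) /\ lacts s (B s) = sone F.
  split; first exact: (ec_mul ec (ec_poly ec g) cB).
  by rewrite lacts_fsmul // ?hB ?smul_one //; exact: (ec_poly ec g).
rewrite /B; elim: s s0 => [|l s ih]; first by rewrite big_nil.
rewrite inE negb_or eq_sym => /andP[l0 /ih[cB hB]]; rewrite big_cons.
rewrite -[smul _ _]/(fsmul (linv l) (B s)).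
have cl := ec_linv ec l; split; first exact: (ec_mul ec cl cB).
rewrite /= lacts_fsmul // [lacts s _]hB smul_one.
exact: (ec_inv ec l0).
Qed.

Lemma expand_presentation g s : 0 \notin s ->
  exists g' s', [/\ 0 \notin s', frac_of g s = frac_of g' s'
    & expand linv (frac_of g s) = ser_of g' s'].
Proof.
move=> s0; rewrite /expand; case: xgetP => [A _ [g' [s' [s0' e ->]]]|].
  by exists g', s'.
by move=> /(_ (ser_of g s)) []; exists g, s.
Qed.

(** Writing s also for the product of its forms: if s A = g and s' A' = g' with
    g / s = g' / s', then s s' A = s' g = s g' = s s' A', and s s' acts
    injectively. *)
Lemma expandE g s A : 0 \notin s -> C A ->
  lacts s A = poly_fser g -> expand linv (frac_of g s) = A.
Proof.
move=> s0 cA hA; have [g' [s' [s0' e ->]]] := expand_presentation g s0.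
have [cA' hA'] := ser_ofP g' s0'.
have s20 : 0 \notin s ++ s' by rewrite mem_cat negb_or s0.
apply: (lacts_inj s20) => //; rewrite !lacts_cat hA' lactsC hA.
by rewrite -!poly_fser_prod; congr poly_fser; apply/esym/frac_of_eq.
Qed.

Lemma expand_inj : {in @ratS F &, injective (expand linv)}.
Proof.
move=> _ _ /set_mem[g [s [s0 ->]]] /set_mem[g' [s' [s0' ->]]].
have [c h] := ser_ofP g s0; have [c' h'] := ser_ofP g' s0'.
rewrite (expandE s0 c h) (expandE s0' c' h') => e.
apply/frac_of_eq => //; apply: poly_fser_inj.
by rewrite !poly_fser_prod -h -h' e lactsC.
Qed.

End Expansion.

(** * Exchanging the two variables *)

Section Swap.
Variable F : fieldType.
Implicit Types (A B : fseries (int * int) F).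

Definition fswap A : fseries (int * int) F := fun m => A (m.2, m.1).

Lemma fswapK : involutive fswap.
Proof. by move=> A; apply/funext => -[]. Qed.

Lemma fswap_lact l A : fswap (lact l A) = lact (l.2, l.1) (fswap A).
Proof. by apply/funext => -[p q]; rewrite lactE /fswap /= lactE addrC. Qed.

Lemma fswap_sone : fswap (sone F) = sone F.
Proof. by apply/funext => -[p q]; rewrite /fswap /= !soneE andbC. Qed.

Lemma fswap_smul A B : fswap (fsmul A B) = fsmul (fswap A) (fswap B).
Proof.
apply/funext => -[p q]; rewrite /fswap /fsmul /smul /=.
by rewrite (@reindex_fsbigT _ _ _ _ _ (fun i : int * int => (i.2, i.1))) //;
  exists (fun i : int * int => (i.2, i.1)) => -[].
Qed.

Definition left_fseries : set (fseries (int * int) F) :=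
  [set A | right_fseries (fswap A)].

Lemma linv21E l : linv21 l = fswap (linv12 (l.2, l.1)).
Proof. by []. Qed.

Lemma pswap_neq0 (l : F * F) : l != 0 -> (l.2, l.1) != 0.
Proof. by case: l => a b; apply: contra => /eqP[-> ->]. Qed.

Lemma left_fseries_poly g : left_fseries (poly_fser g).
Proof.
have [N hN] := poly_fser_supp g; exists N%:Z, 0 => p q.
by move=> /hN[].
Qed.

Hypothesis charF0 : [pchar F] =i pred0.

Lemma expansion12 : expansion_class (@right_fseries F) (@linv12 F).
Proof.
split.
- exact: right_fseries_poly.
- exact: right_fseries_mul.
- exact: right_fseries_fin.
- exact: right_fseries_lact.
- exact: right_fseries_lact_inj.
- exact: right_fseries_linv12.
- exact: lact_linv12.
Qed.

Lemma expansion21 : expansion_class left_fseries (@linv21 F).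
Proof.
split; rewrite /left_fseries /=.
- exact: left_fseries_poly.
- by move=> A B cA cB; rewrite fswap_smul; apply: right_fseries_mul.
- move=> A B m cA cB.
  have := finite_image (fun i : int * int => (i.2, i.1))
    (right_fseries_fin (m.2, m.1) cA cB).
  apply: sub_finite_set => -[i j] /= nz; exists (j, i) => //.
- by move=> l A cA; rewrite fswap_lact; apply: right_fseries_lact.
- move=> l A B l0 cA cB e; rewrite -[A]fswapK -[B]fswapK; congr fswap.
  by apply: (right_fseries_lact_inj (pswap_neq0 l0)) => //; rewrite -!fswap_lact e.
- by move=> l; rewrite linv21E fswapK; apply: right_fseries_linv12.
- move=> l l0; rewrite linv21E -[LHS]fswapK fswap_lact fswapK.
  by rewrite lact_linv12 ?fswap_sone // pswap_neq0.
Qed.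

End Swap.

(** * Linear maps on tensor products *)

Section TensorLinearity.
Variable F : fieldType.
Implicit Types (U V W X : lmodType F).

Lemma tmap_bilin V W U X (f : V -> U) (g : W -> X) : linear f -> linear g ->
  bilin (fun v w => tpure (f v) (g w)).
Proof.
move=> hf hg; have [hl hr] := bilin_tpure U X.
by split=> [v|w] a x y; rewrite ?hf ?hg ?hl //; exact: hr.
Qed.

Lemma tmap_linear V W U X (f : V -> U) (g : W -> X) : linear f -> linear g ->
  linear (tmap f g).
Proof. by move=> hf hg; apply/tlift_linear/tmap_bilin. Qed.

Lemma tmap_pure V W U X (f : V -> U) (g : W -> X) v w : linear f -> linear g ->
  tmap f g (tpure v w) = tpure (f v) (g w).
Proof. by move=> hf hg; rewrite /tmap (tliftE (tmap_bilin hf hg)). Qed.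

Lemma tswap_bilin V W : bilin (fun (v : V) (w : W) => tpure w v).
Proof. by have [hl hr] := bilin_tpure W V; split=> [v|w]; [exact: hr|exact: hl]. Qed.

Lemma tassoc_inner_bilin V W U (v : V) :
  bilin (fun (w : W) (u : U) => tpure (tpure v w) u).
Proof.
have [hl hr] := bilin_tpure V W; have [hl' hr'] := bilin_tpure (tens V W) U.
by split=> [w|u] a x y; rewrite ?hl ?hl' //; exact: hr'.
Qed.

Lemma tassoc_bilin V W U :
  bilin (fun (v : V) (t : tens W U) => tlift (fun w u => tpure (tpure v w) u) t).
Proof.
split=> [v|t] /=; first exact/tlift_linear/tassoc_inner_bilin.
move=> a x y; rewrite /tlift scaler_sumr -big_split; apply: eq_bigr => -[w u] _ /=.
have [_ hr] := bilin_tpure V W; have [_ hr'] := bilin_tpure (tens V W) U.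
by have := hr w a x y; rewrite /= => ->; exact: hr'.
Qed.

Lemma tassoc_linear V W U : linear (@tassoc F V W U).
Proof. exact/tlift_linear/tassoc_bilin. Qed.

Lemma idfun_linear V : linear (@idfun V).
Proof. by []. Qed.

Lemma tswap_linear V W : linear (@tswap F V W).
Proof. exact/tlift_linear/tswap_bilin. Qed.

Lemma linear_sum_seq U V (I : Type) (s : seq I) (h : U -> V) (f : I -> U) :
  linear h -> h (\sum_(i <- s) f i) = \sum_(i <- s) h (f i).
Proof.
move=> hl; elim: s => [|i s ih]; first by rewrite !big_nil; exact: linear_for0 hl.
by rewrite !big_cons -ih; have := hl 1 (f i) (\sum_(j <- s) f j); rewrite !scale1r.
Qed.

End TensorLinearity.

(** * Weights *)

Section Grading.
Variable F : fieldType.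
Implicit Types (U V W : lmodType F).

Lemma tgrade_pure V W (Vg : int -> set V) (Wg : int -> set W) n k v w :
  Vg k v -> Wg (n - k) w -> tgrade Vg Wg n (tpure v w).
Proof.
move=> hv hw; exists [:: (v, w)]; last by rewrite big_seq1.
by move=> p; rewrite inE => /eqP ->; exists k.
Qed.

Lemma tgrade_sum V W (Vg : int -> set V) (Wg : int -> set W) n (I : eqType)
    (s : seq I) (f : I -> tens V W) :
  (forall i, i \in s -> tgrade Vg Wg n (f i)) -> tgrade Vg Wg n (\sum_(i <- s) f i).
Proof.
elim: s => [|i s ih] h; first by rewrite big_nil; exists [::]; rewrite ?big_nil.
rewrite big_cons; have [s1 h1 ->] := h i (mem_head _ _).
have [|s2 h2 ->] := ih; first by move=> j js; apply: h; rewrite inE js orbT.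
exists (s1 ++ s2); last by rewrite big_cat.
by move=> p; rewrite mem_cat => /orP[/h1|/h2].
Qed.

Lemma tgrade_linear V W V' W' (Vg : int -> set V) (Wg : int -> set W)
    (Vg' : int -> set V') (Wg' : int -> set W') n n' (h : tens V W -> tens V' W') x :
  linear h ->
  (forall k v w, Vg k v -> Wg (n - k) w -> tgrade Vg' Wg' n' (h (tpure v w))) ->
  tgrade Vg Wg n x -> tgrade Vg' Wg' n' (h x).
Proof.
move=> hl hp [s hs ->]; rewrite (linear_sum_seq _ _ hl).
by apply: tgrade_sum => p /hs [k [h1 h2]]; apply: hp h1 h2.
Qed.

Lemma finite_int_bound (A : set int) : finite_set A ->
  exists N : nat, forall k, A k -> - N%:Z <= k <= N%:Z.
Proof.
move=> /finite_seqP[s ->]; exists (\sum_(k <- s) `|k|)%N => k /= ks.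
by rewrite (big_rem k) //=; lia.
Qed.

(** A vector has finitely many homogeneous components, of weights r say, and
    phi detects finitely many weights, so r - (m.1 + m.2) takes finitely many
    values where the pairing does not vanish. *)
Lemma paired_degree_bounds V W (Vg : int -> set V) (Wg : int -> set W)
    (phi : {scalar W}) (J : V -> fseries (int * int) W) (v : V) :
  grading Vg -> graded_dual Wg phi -> (forall m, linear (J^~ m)) ->
  (forall r u m, Vg r u -> Wg (r - m.1 - m.2) (J u m)) ->
  exists N : nat, forall m, phi (J v m) != 0 -> - N%:Z <= m.1 + m.2 <= N%:Z.
Proof.
move=> [_ /(_ v)[f [[finf fV ev] _]]] fin_phi Jl Jg.
have [M hM] := finite_int_bound fin_phi.
have [K hK] := finite_int_bound (finite_seq (finite_support 0 setT f)).
exists (M + K)%N => m; rewrite ev (linear_sum_seq _ _ (Jl m)) raddf_sum => nz.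
have [k [ks knz]] : exists k, k \in finite_support 0 setT f /\ phi (J (f k) m) != 0.
  apply/not_existsP => h; move/negP: nz; apply; apply/eqP.
  apply: big1_seq => k /andP[_ ks]; apply/eqP/negPn/negP => knz.
  by apply: (h k).
have /hM : (exists2 w, Wg (k - m.1 - m.2) w & phi w != 0).
  by exists (J (f k) m) => //; exact: Jg (fV k).
by have := hK k ks; lia.
Qed.

End Grading.

(** * The iterated coproducts *)

Section IteratedCoproducts.
Variables (F : fieldType) (V : lmodType F).
Variables (Y : {linear V -> (int -> tens V V)}) (c : {scalar V}).
Variables (Vg : int -> set V) (hV : graded_vertex_coalgebra Y c Vg).

Lemma Y_linear n : linear (fun v => Y v n).
Proof. by move=> a u v; rewrite linearP. Qed.

Lemma iter_right_linear m : linear (fun v => iter_right Y v m).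
Proof.
move=> a u v; rewrite /iter_right Y_linear.
by rewrite (tmap_linear (@idfun_linear F V) (Y_linear m.2)) tassoc_linear.
Qed.

Lemma iter_swapE v m :
  iter_swap Y v m = tmap (@tswap F V V) idfun (iter_right Y v (m.2, m.1)).
Proof. by []. Qed.

Lemma iter_swap_linear m : linear (fun v => iter_swap Y v m).
Proof.
move=> a u v; rewrite !iter_swapE iter_right_linear.
by rewrite (tmap_linear (@tswap_linear F V V) (@idfun_linear F V)).
Qed.

Lemma iter_left_linear m : linear (fun v => iter_left Y v m).
Proof.
move=> a u v; rewrite /iter_left Y_linear.
by rewrite (tmap_linear (Y_linear m.1) (@idfun_linear F V)).
Qed.

Lemma Y_weight r v n : Vg r v -> tgrade Vg Vg (r - n) (Y v n).
Proof.
move=> /(gvc_weight hV (- n - 1)); rewrite /Delta.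
by rewrite opprD !opprK addrK addrA subrK.
Qed.

Lemma iter_right_weight r v m : Vg r v ->
  tgrade (tgrade Vg Vg) Vg (r - m.1 - m.2) (iter_right Y v m).
Proof.
move=> /(Y_weight m.1); rewrite /iter_right.
have ml := tmap_linear (@idfun_linear F V) (Y_linear m.2).
apply: (@tgrade_linear F _ _ _ _ _ _ _ _ _ _
  (fun t => tassoc (tmap idfun (fun u => Y u m.2) t))) => [a x y|k x y hx hy].
  by rewrite ml tassoc_linear.
rewrite (tmap_pure _ _ (@idfun_linear F V) (Y_linear m.2)) /tassoc.
rewrite (tliftE (@tassoc_bilin F V V V)).
apply: tgrade_linear (Y_weight m.2 hy) => [|l w u hw hu].
  exact/tlift_linear/tassoc_inner_bilin.
rewrite (tliftE (@tassoc_inner_bilin F V V V _)).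
apply: (@tgrade_pure F _ _ _ _ _ (k + l)).
  by apply: (@tgrade_pure F _ _ _ _ _ k) => //; rewrite addrC addKr.
by move: hu; congr (Vg _ u); lia.
Qed.

Lemma iter_swap_weight r v m : Vg r v ->
  tgrade (tgrade Vg Vg) Vg (r - m.1 - m.2) (iter_swap Y v m).
Proof.
move=> /(iter_right_weight (m.2, m.1)); rewrite iter_swapE /= addrAC.
have tl := @tswap_linear F V V.
apply: tgrade_linear => [|k x y hx hy]; first exact: tmap_linear.
rewrite (tmap_pure _ _ tl (@idfun_linear F V)).
apply: tgrade_pure hy; apply: tgrade_linear hx => // l u w hu hw.
rewrite /tswap (tliftE (@tswap_bilin F V V)).
by apply: tgrade_pure hw _; rewrite subKr.
Qed.

Lemma iter_left_weight r v m : Vg r v ->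
  tgrade (tgrade Vg Vg) Vg (r - m.1 - m.2) (iter_left Y v m).
Proof.
move=> /(Y_weight m.2); rewrite /iter_left.
apply: tgrade_linear => [|k x y hx hy].
  exact: tmap_linear (Y_linear _) (@idfun_linear F V).
rewrite (tmap_pure _ _ (Y_linear m.1) (@idfun_linear F V)).
apply: tgrade_pure (Y_weight m.1 hx) _.
by move: hy; congr (Vg _ y); lia.
Qed.

(** In each iterated coproduct it is the inner application of Y, to v itself,
    that truncates uniformly: its variable is x1 in the first and x2 in the
    other two. *)
Lemma Y_truncated v : exists N : int, forall m : int * int,
  [/\ N < m.1 -> iter_right Y v m = 0, N < m.2 -> iter_swap Y v m = 0
    & N < m.2 -> iter_left Y v m = 0].
Proof.
have [N hN] := truncation (gvc_vertex hV) v; exists N => m.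
have l1 k := linear_for0 (tmap_linear (@idfun_linear F V) (Y_linear k)).
have l2 := linear_for0 (@tassoc_linear F V V V).
have l3 := linear_for0 (tmap_linear (@tswap_linear F V V) (@idfun_linear F V)).
have l4 k := linear_for0 (tmap_linear (Y_linear k) (@idfun_linear F V)).
split=> /hN e.
- by rewrite /iter_right e l1 l2.
- by rewrite /iter_swap e l1 l2 l3.
- by rewrite /iter_left e l4.
Qed.

End IteratedCoproducts.

(** * Weak cocommutativity *)

Section LocalityFromJacobi.
Variables (F : fieldType) (charF0 : [pchar F] =i pred0).

Lemma fsmul_prod_lin (s : seq (F * F)) (A : fseries (int * int) F) :
  fsmul (lacts s (sone F)) A = lacts s A.
Proof.
rewrite fsmulC; elim: s => [|l s ih] /=; first exact: smul_one.
rewrite -lact_smulr ?ih // => m.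
have := poly_fser_prod s 1; rewrite poly_fser1 => <-.
have [N hN] := poly_fser_supp (\prod_(l0 <- s) lin l0 * 1).
case: m => p q.
apply: sub_finite_set (finite_rect (p - N%:Z) p (q - N%:Z) q) => -[i j] /=.
by rewrite mulf_eq0 negb_or => /andP[_ /hN[/= ? ? ? ?]]; lia.
Qed.

Lemma binexp_nat (a b : F) (t : nat) : a != 0 ->
  binexp a b t%:Z = lacts (nseq t (a, b)) (sone F).
Proof.
move=> a0; elim: t => [|t ih]; first exact: binexp0.
by rewrite -addn1 PoszD -(lact_binexp charF0) // ih addn1.
Qed.

Lemma lacts_opp (l : F * F) (t : nat) A m :
  lacts (nseq t (- l)) A m = (-1) ^+ t * lacts (nseq t l) A m.
Proof.
elim: t m => [|t ih] m /=; first by rewrite mul1r.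
by rewrite /lact !ih exprS /=; ring.
Qed.

(** The coefficient of x0^(-t-1) in x0^-1 delta((x1 - x2) / x0) is
    (x1 - x2)^t, which is a polynomial because t is nonnegative. *)
Lemma delta_left (t : nat) (m : int * int) :
  delta3 1 (- t%:Z - 1) m.1 m.2 = lacts (nseq t (1, -1)) (sone F) m.
Proof.
rewrite -binexp_nat ?oner_neq0 // /delta3.
have -> : - (- t%:Z - 1) - 1 = t%:Z by lia.
by rewrite exp1rz mul1r; case: m.
Qed.

Lemma fswap_lacts (s : seq (F * F)) A :
  fswap (lacts s A) = lacts [seq (l.2, l.1) | l <- s] (fswap A).
Proof. by elim: s => //= l s <-; rewrite fswap_lact. Qed.

(** In x0^-1 delta((x2 - x1) / (- x0)) the coefficient is
    (-1)^t (x2 - x1)^t, which is the same polynomial. *)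
Lemma delta_right (t : nat) (m : int * int) :
  delta3 (-1) (- t%:Z - 1) m.2 m.1 = lacts (nseq t (1, -1)) (sone F) m.
Proof.
rewrite /delta3; have -> : - (- t%:Z - 1) - 1 = t%:Z by lia.
rewrite -[binexp _ _ _ _]/(fswap (binexp 1 (-1) t%:Z) m).
rewrite binexp_nat ?oner_neq0 // fswap_lacts fswap_sone map_nseq /=.
have -> : (-1, 1) = - (1, -1) :> F * F by congr pair; rewrite opprK.
rewrite lacts_opp mulrA.
have -> : (-1) ^ (- t%:Z) = (-1) ^+ t :> F.
  by rewrite -exprnN invr_sign.
by rewrite -expr2 sqrr_sign mul1r.
Qed.

(** A term of the Jacobi identity whose second factor is free of x0: its
    coefficient of x0^n is a product of series in x1 and x2 only. When the
    slice of D at x0^n is a product of linear forms, the sum is finite and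
    commutes with phi. *)
Lemma smul_slice (W : lmodType F) (phi : {scalar W})
    (D : fseries (int * int * int) F) (s : seq (F * F))
    (B : fseries (int * int) W) (n p q : int) :
  (forall i j, D (n, i, j) = lacts s (sone F) (i, j)) ->
  phi (smul D (fun m => if m.1.1 == 0 then B (m.1.2, m.2) else 0) (n, p, q)) =
  lacts s (fun m => phi (B m)) (p, q).
Proof.
move=> hD; rewrite -fsmul_prod_lin /fsmul /smul.
have e1 : lacts s (sone F) = poly_fser (\prod_(l <- s) lin l).
  by rewrite -[X in poly_fser X]mulr1 poly_fser_prod poly_fser1.
have [N hN] := poly_fser_supp (\prod_(l <- s) lin l).
rewrite -e1 in hN.
have fin : finite_set [set j | lacts s (sone F) j != 0].
  by apply: sub_finite_set (finite_rect 0 N%:Z 0 N%:Z) => j /= /hN[]; lia.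
pose X := fset_set [set j | lacts s (sone F) j != 0].
have XP j : j \notin X -> lacts s (sone F) j = 0.
  rewrite in_fset_set // => /negP h; apply/eqP/negPn/negP => nz.
  by apply: h; rewrite inE.
rewrite (fsbigTE X); last by move=> j /XP ->; rewrite scale0r.
rewrite (fsbigTE ((fun j : int * int => (n, j.1, j.2)) @` X)%fset); last first.
  move=> [[i0 i1] i2] /= h; have [e|] := eqVneq i0 n; last first.
    move=> ne; rewrite ifF ?scaler0 //; apply/negbTE.
    by rewrite -[X in X != _]/(n - i0) subr_eq0 eq_sym.
  rewrite e hD XP ?scale0r //; apply: contra h => h; apply/imfsetP.
  by exists (i1, i2) => //; rewrite e.
rewrite big_imfset /=; last by move=> [? ?] [? ?] _ _ [-> ->].
rewrite raddf_sum; apply: eq_bigr => -[i j] _ /=.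
by rewrite subrr eqxx hD linearZ.
Qed.

(** The exponent of x0 is at least - L - N in the paired right-hand side of the
    Jacobi identity, if L bounds the total degree and N truncates Y v. *)
Lemma locality (V : lmodType F) (Y : {linear V -> (int -> tens V V)})
    (c : {scalar V}) (Vg : int -> set V) (hV : graded_vertex_coalgebra Y c Vg)
    (v' : {scalar (tens3 V)}) (hv' : graded_dual (tgrade (tgrade Vg Vg) Vg) v')
    (v : V) :
  exists t : nat,
    lacts (nseq t (1, -1)) (fun m => v' (iter_right Y v m)) =
    lacts (nseq t (1, -1)) (fun m => v' (iter_swap Y v m)).
Proof.
have [L hL] := paired_degree_bounds v (gvc_grading hV) hv'
  (iter_left_linear Y) (@iter_left_weight F V Y c Vg hV).
have [N hN] := Y_truncated hV v.
exists (L + `|N|)%N; set t := (L + _)%N; apply/funext => -[p q].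
have := jacobi_identity (gvc_vertex hV) v; rewrite /jacobi.
set J1 := (X in X - _ = _); set J2 := (X in _ - X = _); set J3 := (X in _ = X) => J.
pose x : int * int * int := (- t%:Z - 1, p, q).
have h1 : v' (J1 x) = lacts (nseq t (1, -1)) (fun m => v' (iter_right Y v m)) (p, q).
  by apply: smul_slice => i j; rewrite -delta_left.
have h2 : v' (J2 x) = lacts (nseq t (1, -1)) (fun m => v' (iter_swap Y v m)) (p, q).
  by apply: smul_slice => i j; rewrite -delta_right.
suff h3 : v' (J3 x) = 0.
  apply/subr0_eq; rewrite -h1 -h2 -h3 -J.
  exact/esym/(raddfB v' (J1 x) (J2 x)).
(* Finitely supported or not, the sum runs over a finite list of vanishing terms. *)
rewrite /J3 /smul raddf_sum big1 // => -[[i0 i1] i2] _ /=.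
rewrite linearZ /=; case: ifP => _; last by rewrite raddf0 mulr0.
apply/eqP; rewrite mulf_eq0 -[_ || _]negbK negb_or; apply/negP => /andP[].
rewrite /delta3 /binexp /= mulf_eq0 negb_or => /andP[_].
case: ifP => [/andP[i0_ge0 _] _|]; last by rewrite eqxx.
set m := (_, _) => nz; have := hL m nz.
have [_ _ hm] := hN m.
have : m.2 <= N.
  by rewrite leNgt; apply: contra nz => /hm ->; rewrite raddf0.
rewrite /m /=; lia.
Qed.

End LocalityFromJacobi.

(** * Rationality *)

Section Rationality.
Variables (F : fieldType) (charF0 : [pchar F] =i pred0).

Lemma lacts_shift1 (r : nat) (A : fseries (int * int) F) p q :
  lacts (nseq r (1, 0)) A (p, q) = A (p - r%:Z, q).
Proof.
elim: r p q => [|r ih] p q /=; first by rewrite subr0.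
by rewrite lactE /= mul1r mul0r addr0 ih; congr (A (_, _)); lia.
Qed.

Lemma lacts_shift2 (r : nat) (A : fseries (int * int) F) p q :
  lacts (nseq r (0, 1)) A (p, q) = A (p, q - r%:Z).
Proof.
elim: r p q => [|r ih] p q /=; first by rewrite subr0.
by rewrite lactE /= mul1r mul0r add0r ih; congr (A (_, _)); lia.
Qed.

(** A right series bounds the exponent of x1 above and that of x2 below, a left
    series does the opposite; multiplying by x1^r x2^s removes the negative
    exponents. *)
Lemma laurent_poly (A : fseries (int * int) F) :
  right_fseries A -> left_fseries A ->
  exists (r s : nat) g,
    lacts (nseq r (1, 0) ++ nseq s (0, 1)) A = poly_fser g.
Proof.
move=> [N [M hA]] [N' [M' hA']]; exists `|M'|%N, `|M|%N.
have bound m : A m != 0 -> [/\ M' <= m.1, m.1 <= N, M <= m.2 & m.2 <= N'].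
  by case: m => p q nz; have [] := hA p q nz; have [] := hA' q p nz; split.
apply: (@fser_poly F _ (`|M'| + `|M| + `|N| + `|N'|)%N) => -[p q].
by rewrite lacts_cat lacts_shift1 lacts_shift2 => /bound[/=]; split; lia.
Qed.

Lemma tofrac_lin (a b : F) :
  tofrac (lin (a, b)) =
    tofrac (a%:P%:P) * tofrac (px1 F) + tofrac (b%:P%:P) * tofrac (px2 F).
Proof. by rewrite /lin tofracD !tofracM. Qed.

(** Multiplication by (x1 - x2)^t preserves both kinds of boundedness, so the
    common product, being R times a form and S times the same form, is bounded
    in all four directions. *)
Lemma common_expansion (R S : fseries (int * int) F) (t : nat) :
  right_fseries R -> left_fseries S ->
  lacts (nseq t (1, -1)) R = lacts (nseq t (1, -1)) S ->
  exists (g : {poly {poly F}}) (r s : nat) (d : seq (F * F)),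
    [/\ 0 \notin d, R = iota12 (frac_of g d), S = iota21 (frac_of g d)
      & frac_of g d = tofrac g / (tofrac (px1 F) ^+ r * tofrac (px2 F) ^+ s
                             * (tofrac (px1 F) - tofrac (px2 F)) ^+ t)].
Proof.
move=> hR hS e.
have e12 := expansion12 charF0; have e21 := expansion21 charF0.
have [r [s [g hg]]] : exists (r s : nat) g,
    lacts (nseq r (1, 0) ++ nseq s (0, 1)) (lacts (nseq t (1, -1)) R) = poly_fser g.
  apply: laurent_poly; first exact: (ec_lacts e12).
  by rewrite e; exact: (ec_lacts e21).
pose d := (nseq r (1, 0) ++ nseq s (0, 1)) ++ nseq t (1, -1) : seq (F * F).
exists g, r, s, d.
have d0 : 0 \notin d.
  rewrite !mem_cat !mem_nseq -[0 == (1, 0)]/(_ && _) -[0 == (0, 1)]/(_ && _).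
  rewrite -[0 == (1, -1)]/(_ && _) /= ![0 == 1]eq_sym oner_eq0 /=.
  by rewrite !andbF.
split=> //.
- by apply/esym/(expandE e12 d0 hR); rewrite lacts_cat.
- by apply/esym/(expandE e21 d0 hS); rewrite lacts_cat -e.
- rewrite /frac_of /d !big_cat /= !big_nseq.
  rewrite !iter_mulr_1 !tofrac_lin.
  rewrite !(polyCN, polyC1, polyC0) tofracN tofrac1 tofrac0.
  by rewrite !mul1r !mul0r addr0 add0r mulN1r.
Qed.

End Rationality.

(** Only the exponent that truncation bounds above needs an argument; the total
    degree then bounds the other one below. *)
Lemma right_fseries_iter (F : fieldType) (V : lmodType F)
    (Y : {linear V -> (int -> tens V V)}) (c : {scalar V})
    (Vg : int -> set V) (hV : graded_vertex_coalgebra Y c Vg)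
    (v' : {scalar (tens3 V)}) (hv' : graded_dual (tgrade (tgrade Vg Vg) Vg) v')
    (v : V) :
  right_fseries (fun m => v' (iter_right Y v m)) /\
  left_fseries (fun m => v' (iter_swap Y v m)).
Proof.
have [N hN] := Y_truncated hV v; split.
  have [L hL] := paired_degree_bounds v (gvc_grading hV) hv'
    (iter_right_linear Y) (@iter_right_weight F V Y c Vg hV).
  exists N, (- L%:Z - N) => p q nz; have [hr _ _] := hN (p, q).
  have hp : p <= N by rewrite leNgt; apply: contra nz => /hr ->; rewrite raddf0.
  by have /= := hL _ nz; split; lia.
have [L hL] := paired_degree_bounds v (gvc_grading hV) hv'
  (iter_swap_linear Y) (@iter_swap_weight F V Y c Vg hV).
exists N, (- L%:Z - N) => q p nz; have [_ hs _] := hN (p, q).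
have hq : q <= N.
  by rewrite leNgt; apply: contra nz => /hs; rewrite /fswap /= => ->; rewrite raddf0.
by have /= := hL (p, q) nz; split; lia.
Qed.

Theorem proposition2p7 (F : fieldType) (charF0 : [pchar F] =i pred0)
    (V : lmodType F) (Y : {linear V -> (int -> tens V V)}) (c : {scalar V})
    (Vg : int -> set V) (hV : graded_vertex_coalgebra Y c Vg)
    (v' : {scalar (tens3 V)}) (hv' : graded_dual (tgrade (tgrade Vg Vg) Vg) v')
    (v : V) :
  let R : fseries (int * int) F := fun m => v' (iter_right Y v m) in
  let S : fseries (int * int) F := fun m => v' (iter_swap Y v m) in
  (right_fseries R /\
   exists f : ratfun F,
     [/\ ratS f, R = iota12 f,
         forall f', ratS f' -> R = iota12 f' -> f' = f
       & exists (g : {poly {poly F}}) (r s t : nat),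
           f = tofrac g / (tofrac (px1 F) ^+ r * tofrac (px2 F) ^+ s
                             * (tofrac (px1 F) - tofrac (px2 F)) ^+ t)]) /\
  ([/\ (@iota12 F @` @ratS F) R, (@iota21 F @` @ratS F) S
     & iota12_inv R = iota21_inv S]).
Proof.
move=> R S.
have [rR lS] := right_fseries_iter hV hv' v.
have [t ht] := locality charF0 hV hv' v.
have [g [r [s [d [d0 eR eS ef]]]]] := common_expansion charF0 rR lS ht.
have fS : ratS (frac_of g d) by exists g, d.
have inj12 : {in @ratS F &, injective (@iota12 F)}.
  exact: expand_inj (expansion12 charF0).
have inj21 : {in @ratS F &, injective (@iota21 F)}.
  exact: expand_inj (expansion21 charF0).
have k12 : {in @ratS F, cancel (@iota12 F) (@iota12_inv F)} by exact: pinvKV.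
have k21 : {in @ratS F, cancel (@iota21 F) (@iota21_inv F)} by exact: pinvKV.
split; split=> //.
- exists (frac_of g d); split=> //; last by exists g, r, s, t.
  by move=> f' f'S; rewrite /R eR => /esym; apply: inj12; apply/mem_set.
- by exists (frac_of g d).
- by exists (frac_of g d).
- by rewrite /R /S eR eS k12 ?k21 //; apply/mem_set.
Qed.
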